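(* Let $X$ be a set and let $\mathcal F\subset\mathbb R^X$ be pointwise lower bounded and pseudo concave on $X$. Then $$\inf_{m\in\mathbb P(\mathcal F;\mathcal E(X))}\ \sup_{x\in X}\int_{\mathcal F} f(x)\,m(df)=\sup_{x\in X}\ \inf_{f\in\mathcal F}f(x)$$ and the infimum over $\mathbb P(\mathcal F;\mathcal E(X))$ is attained. If, in addition, $\mathcal E(X)$ (viewed as a family of functions on $\mathcal F$) is pseudo $B$-convex on $\mathcal F$, then $$\inf_{f\in\mathcal F}\ \sup_{x\in X}f(x)=\sup_{x\in X}\ \inf_{f\in\mathcal F}f(x).$$
   Context: All underlying sets on which functions or probabilities are considered are non-empty. $\mathbb R^X$ is the set of all real-valued functions on $X$. For a set $Y$, $\mathbb P(Y)$ is the set of all finitely additive probabilities defined on the power set of $Y$; for $m\in\mathbb P(Y)$, $L^1(m)$ is the space of $m$-integrable functions (Dunford–Schwartz integral for finitely additive set functions). For $\mathcal G\subset\mathbb R^Y$ put $\mathbb P(Y;\mathcal G)=\{m\in\mathbb P(Y):\mathcal G\subset L^1(m)\}$. $\mathcal E(X)$ is the set of all evaluations $e_x$, $x\in X$, regarded here as functions on $\mathcal F$: $e_x(f)=f(x)$. Thus $\mathbb P(\mathcal F;\mathcal E(X))$ is the set of finitely additive probabilities $m$ on the power set of $\mathcal F$ such that $f\mapsto f(x)$ is $m$-integrable for every $x\in X$. $\mathcal F\subset\mathbb R^X$ is pointwise lower bounded if $\inf_{f\in\mathcal F}f(x)>-\infty$ for every $x\in X$. $\mathcal F\subset\mathbb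 R^X$ is pseudo concave on $X$ if for all $x,x'\in X$ and $0\le t\le1$ there is a sequence $(x_n)_{n\in\mathbb N}$ in $X$ such that $tf(x)+(1-t)f(x')\le f(x_n)+2^{-n}$ for all $f\in\mathcal F$ and $n\in\mathbb N$. A family $\mathcal G\subset\mathbb R^Y$ is pseudo $B$-convex on $Y$ if for each $m\in\mathbb P(Y;\mathcal G)$ there is a sequence $(y_n)_{n\in\mathbb N}$ in $Y$ (a pseudo sub barycentre of $m$ on $\mathcal G$) such that $\int_Y g(y)\,m(dy)+2^{-n}\ge g(y_n)$ for all $g\in\mathcal G$ and $n\in\mathbb N$. In the claim this is applied with $Y=\mathcal F$ and $\mathcal G=\mathcal E(X)$. *)

(* Defs.v *)
From mathcomp Require Import all_boot all_order all_algebra.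
From mathcomp Require Import all_classical all_reals all_analysis.

Set Implicit Arguments.
Unset Strict Implicit.
Unset Printing Implicit Defensive.

Import Order.TTheory GRing.Theory Num.Theory.
Import numFieldNormedType.Exports.

Local Open Scope classical_set_scope.
Local Open Scope ring_scope.

Definition fa_probability (R : realType) (Y : Type) (m : set Y -> R) : Prop :=
  [/\ forall A, 0 <= m A,
      m [set: Y] = 1
    & forall A B, A `&` B = set0 -> m (A `|` B) = m A + m B].

Definition simple_integral (R : realType) (Y : Type) (m : set Y -> R)
    (s : Y -> R) : R :=
  \sum_(r \in range s) r * m (s @^-1` [set r]).

(* Dunford-Schwartz integrability of [g] with integral [v]: some sequence of
   simple functions converges to [g] in [m]-measure, is Cauchy in [L^1]-mean,
   and has integrals converging to [v].  Since [m] is defined on the whole power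
   set, there is no measurability requirement and no outer measure. *)
Definition has_ds_integral (R : realType) (Y : Type) (m : set Y -> R)
    (g : Y -> R) (v : R) : Prop :=
  exists s : nat -> {fimfun Y >-> R},
    [/\ forall e : R, 0 < e ->
          m [set y | e < `|s n y - g y|] @[n --> \oo] --> (0 : R),
        forall e : R, 0 < e -> exists N, forall j k, (N <= j)%N -> (N <= k)%N ->
          simple_integral m (fun y => `|s j y - s k y|) < e
      & simple_integral m (s n) @[n --> \oo] --> v].

Definition L1 (R : realType) (Y : Type) (m : set Y -> R) : set (Y -> R) :=
  [set g | exists v, has_ds_integral m g v].

(* The value of the integral is unique for a finitely additive probability [m];
   it is the junk value [0] off [L1 m]. *)
Definition ds_integral (R : realType) (Y : Type) (m : set Y -> R)
    (g : Y -> R) : R :=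
  xget 0 [set v | has_ds_integral m g v].

Definition fa_probabilities (R : realType) (Y : Type) (G : set (Y -> R)) :
    set (set Y -> R) :=
  [set m | fa_probability m /\ G `<=` L1 m].

(* [F : set (X -> R)] is coerced to the type of its elements. *)
Definition evaluation (R : realType) (X : Type) (F : set (X -> R)) (x : X) :
    F -> R :=
  fun f => val f x.
Arguments evaluation {R X} F x f.

Definition evaluations (R : realType) (X : Type) (F : set (X -> R)) :
    set (F -> R) :=
  range (evaluation F).
Arguments evaluations {R X} F _.

Definition pointwise_lower_bounded (R : realType) (X : Type)
    (F : set (X -> R)) : Prop :=
  forall x, (-oo < ereal_inf [set (f x)%:E | f in F])%E.

Definition pseudo_concave (R : realType) (X : Type) (F : set (X -> R)) : Prop :=
  forall (x x' : X) (t : R), 0 <= t <= 1 ->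
    exists xs : nat -> X, forall f n, F f ->
      t * f x + (1 - t) * f x' <= f (xs n) + 2 ^- n.

Definition pseudo_B_convex (R : realType) (Y : Type) (G : set (Y -> R)) : Prop :=
  forall m, fa_probabilities G m ->
    exists ys : nat -> Y, forall g n, G g ->
      g (ys n) <= ds_integral m g + 2 ^- n.

(* Main.v *)
Require Import Defs.
From HB Require Import structures.
From mathcomp Require Import all_boot all_order all_algebra.
From mathcomp Require Import all_classical all_reals all_analysis.
From mathcomp Require Import ring lra.

(* Write [e_x] for the evaluation at [x] and [c] for the right-hand side, assumed
   finite (if it is [+oo], a Dirac mass does).  On simple functions over [F], put
     p(u) = inf { t | u <= t + k (e_x - c) for some k >= 0 and x in X }.
   Pseudo concavity makes [p] subadditive, and [inf_F e_x <= c] keeps it finite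
   with [p(0) = 0].  A linear functional below [p], given by Hahn-Banach, is
   integration against a finitely additive probability [m] such that
   [int s dm <= c] for every simple [s <= e_x].  As [e_x] is bounded below, its
   dyadic approximations then converge to it in the Dunford-Schwartz sense, and
   [int e_x dm <= c].  Hence [m] attains the infimum; its pseudo sub barycentres
   give the second equality. *)

Set Implicit Arguments.
Unset Strict Implicit.
Unset Printing Implicit Defensive.

Import Order.TTheory GRing.Theory Num.Theory.
Import numFieldNormedType.Exports.

Local Open Scope classical_set_scope.
Local Open Scope ring_scope.

(** * Hahn-Banach: a linear functional below a sublinear one *)

Section HahnBanach.
Variables (R : realType) (V : lmodType R).

Definition sublinear (p : V -> R) : Prop :=
  (forall u v, p (u + v) <= p u + p v) /\
  (forall a u, 0 <= a -> p (a *: u) = a * p u).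

Definition below (p q : V -> R) : Prop := forall u, q u <= p u.

Lemma sublinear0 p : sublinear p -> p 0 = 0.
Proof. by move=> [_ pZ]; rewrite -(scale0r 0) pZ// mul0r. Qed.

Lemma sublinear_oppr p u : sublinear p -> - p (- u) <= p u.
Proof.
move=> sp; have := sp.1 u (- u).
by rewrite subrr sublinear0//; lra.
Qed.

(** The bound is the pointwise infimum of the chain. It is finite because every member [q] satisfies
    [- p (- u) <= - q (- u) <= q u]. *)
Lemma sublinear_chain_inf p (A : set (V -> R)) : A !=set0 ->
  (forall q, A q -> sublinear q /\ below p q) ->
  (forall q r, A q -> A r -> below q r \/ below r q) ->
  exists q0, [/\ sublinear q0, below p q0 & forall q, A q -> below q q0].
Proof.
move=> [qA AqA] Asub Atot.
pose E u : set R := [set q u | q in A].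
have Elb u : has_inf (E u).
  split; first by exists (qA u), qA.
  exists (- p (- u)) => _ [q Aq <-].
  have [sq qp] := Asub q Aq.
  by apply: le_trans (sublinear_oppr u sq); rewrite lerN2.
have infE u q : A q -> inf (E u) <= q u.
  by move=> Aq; apply: ge_inf; [exact: (Elb u).2|exists q].
exists (fun u => inf (E u)); split => //; last 1 first.
- by move=> q Aq u; exact: infE.
- split=> [u v|a u a0].
    rewrite -lerBlDr; apply: lb_le_inf; first exact: (Elb u).1.
    move=> _ [q Aq <-]; rewrite lerBlDl -lerBlDr.
    apply: lb_le_inf; first exact: (Elb v).1.
    move=> _ [r Ar <-]; rewrite lerBlDr.
    (* The smaller of [q] and [r] serves at both [u] and [v]; this is where the chain condition
       gives subadditivity. *)
    have [qr|rq] := Atot _ _ Aq Ar.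
      apply: le_trans (infE _ _ Ar) _.
      by apply: le_trans ((Asub r Ar).1.1 _ _) _; rewrite addrC lerD2l qr.
    apply: le_trans (infE _ _ Aq) _.
    by apply: le_trans ((Asub q Aq).1.1 _ _) _; rewrite addrC lerD2r rq.
  have [->|an0] := eqVneq a 0.
    rewrite scale0r mul0r; apply/eqP; rewrite eq_le; apply/andP; split.
      by apply: le_trans (infE _ _ AqA) _; rewrite sublinear0//;
        exact: (Asub _ AqA).1.
    apply: lb_le_inf; first exact: (Elb 0).1.
    by move=> _ [q Aq <-]; rewrite sublinear0//; exact: (Asub _ Aq).1.
  have agt0 : 0 < a by rewrite lt0r an0.
  apply/eqP; rewrite eq_le; apply/andP; split.
    rewrite -ler_pdivrMl//; apply: lb_le_inf; first exact: (Elb u).1.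
    move=> _ [q Aq <-]; rewrite ler_pdivrMl// -((Asub q Aq).1.2)//.
    exact: infE.
  apply: lb_le_inf; first exact: (Elb _).1.
  by move=> _ [q Aq <-]; rewrite (Asub q Aq).1.2// ler_pM2l// infE.
- by move=> u; apply: le_trans (infE _ _ AqA) ((Asub _ AqA).2 u).
Qed.

Lemma minimal_sublinear p : sublinear p ->
  exists q, [/\ sublinear q, below p q &
    forall r, sublinear r -> below q r -> r = q].
Proof.
move=> sp; pose T := {q : V -> R | sublinear q /\ below p q}.
(* The order is reversed, so that a maximal element in Zorn's lemma is a minimal sublinear
   functional. *)
pose le_rev (q r : T) : bool := `[< below (sval q) (sval r) >].
have /(Zorn (R := le_rev)) : forall q, le_rev q q.
  by move=> q; apply/asboolP => u.
case.
- move=> q r s /asboolP qr /asboolP rs; apply/asboolP => u.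
  exact: le_trans (rs u) (qr u).
- move=> [q Pq] [r Pr] /asboolP qr /asboolP rq; apply: eq_exist.
  by apply/funext => u; apply/eqP; rewrite eq_le rq qr.
- move=> A Atot; have [->|/set0P[q0 Aq0]] := eqVneq A set0.
    by exists (exist _ p (conj sp (fun u => lexx _))).
  have [| | |q [sq pq Aq]] := @sublinear_chain_inf p [set sval r | r in A].
  + by exists (sval q0), q0.
  + by move=> _ [r Ar <-]; exact: svalP r.
  + by move=> _ _ [r Ar <-] [s As <-];
      have [/asboolP|/asboolP] := Atot _ _ Ar As; [left|right].
  exists (exist _ q (conj sq pq)) => r Ar; apply/asboolP; apply: Aq.
  by exists r.
move=> [q [sq pq]] qmin; exists q; split => // r sr qr.
have pr : below p r by move=> u; exact: le_trans (qr u) (pq u).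
have qr' : le_rev (exist _ q (conj sq pq)) (exist _ r (conj sr pr)) by apply/asboolP.
by have /(congr1 sval) := qmin _ qr'.
Qed.

(* The competitor [u |-> inf_(t >= 0) q (u + t v) - t q v] is again sublinear
   and below [q], so minimality forces it to be [q]; [t = 1], [u = - v] then
   gives oddness. *)
Lemma minimal_sublinear_oppr q v : sublinear q ->
  (forall r, sublinear r -> below q r -> r = q) -> q (- v) = - q v.
Proof.
move=> sq qmin.
pose E u : set R := [set q (u + t *: v) - t * q v | t in [set t | 0 <= t]].
have Elb u : has_inf (E u).
  split; first by exists (q (u + 0 *: v) - 0 * q v), 0 => /=.
  (* The lower bound comes from [q (t *: v) <= q (u + t *: v) + q (- u)]. *)
  exists (- q (- u)) => _ [t /= t0 <-].
  rewrite -(sq.2 t v t0).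
  have := sq.1 (u + t *: v) (- u).
  by rewrite addrAC subrr add0r; lra.
have infE u t : 0 <= t -> inf (E u) <= q (u + t *: v) - t * q v.
  by move=> t0; apply: ge_inf; [exact: (Elb u).2|exists t].
have Er : sublinear (fun u => inf (E u)).
  split=> [u w|a u].
    rewrite -lerBlDr; apply: lb_le_inf; first exact: (Elb u).1.
    move=> _ [t /= t0 <-]; rewrite lerBlDl -lerBlDr.
    apply: lb_le_inf; first exact: (Elb w).1.
    move=> _ [s /= s0 <-]; rewrite lerBlDr.
    apply: le_trans (infE _ (t + s) _) _; first exact: addr_ge0.
    have := sq.1 (u + t *: v) (w + s *: v).
    by rewrite addrACA -scalerDl; lra.
  rewrite le_eqVlt => /predU1P[<-|a0].
    rewrite scale0r mul0r; apply/eqP; rewrite eq_le; apply/andP; split.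
      apply: le_trans (infE _ 0 _) _ => //.
      by rewrite scale0r addr0 mul0r subr0 sublinear0.
    apply: lb_le_inf; first exact: (Elb 0).1.
    by move=> _ [t /= t0 <-]; rewrite add0r sq.2// subrr.
  apply/eqP; rewrite eq_le; apply/andP; split.
    rewrite -ler_pdivrMl//; apply: lb_le_inf; first exact: (Elb u).1.
    move=> _ [t /= t0 <-]; rewrite ler_pdivrMl// mulrBr -(sq.2 _ _ (ltW a0)).
    rewrite scalerDr scalerA mulrA; apply: infE.
    by rewrite mulr_ge0// ltW.
  apply: lb_le_inf; first exact: (Elb _).1.
  move=> _ [t /= t0 <-].
  have -> : a *: u + t *: v = a *: (u + (a^-1 * t) *: v).
    by rewrite scalerDr scalerA mulrA mulfV ?mul1r// gt_eqF.
  have -> : t * q v = a * ((a^-1 * t) * q v).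
    by rewrite !mulrA mulfV ?mul1r// gt_eqF.
  rewrite (sq.2 _ _ (ltW a0)) -mulrBr ler_pM2l//; apply: infE.
  by rewrite mulr_ge0// invr_ge0 ltW.
have qE : (fun u => inf (E u)) = q.
  apply: qmin => // u; apply: le_trans (infE _ 0 _) _ => //.
  by rewrite scale0r addr0 mul0r subr0.
apply/eqP; rewrite eq_le; apply/andP; split; last first.
  by have := sublinear_oppr v sq; lra.
have := infE (- v) 1 ler01.
by rewrite scale1r addNr sublinear0// mul1r sub0r -[in q (- v)]qE.
Qed.

(** A minimal sublinear functional below [p] is odd. Oddness turns subadditivity at [- u], [- v]
    into the reverse inequality and extends homogeneity to negative scalars. *)
Lemma hahn_banach p : sublinear p ->
  exists l : V -> R, [/\ forall u v, l (u + v) = l u + l v,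
    forall a u, l (a *: u) = a * l u & forall u, l u <= p u].
Proof.
move=> sp; have [q [sq pq qmin]] := minimal_sublinear sp.
have qN u : q (- u) = - q u by exact: minimal_sublinear_oppr.
exists q; split => // [u v|a u].
  apply/eqP; rewrite eq_le sq.1 /=.
  by have := sq.1 (- u) (- v); rewrite -opprD !qN; lra.
have [a0|a0] := leP 0 a; first exact: sq.2.
apply: oppr_inj; rewrite -qN -scaleNr sq.2 ?mulNr//.
by rewrite oppr_ge0 ltW.
Qed.

End HahnBanach.

(** * Integration of simple functions against a finitely additive probability *)

Section SimpleIntegral.
Variables (R : realType) (Y : Type) (m : set Y -> R).
Hypothesis mP : fa_probability m.
Implicit Types (s t : Y -> R).

Lemma fa_probability_ge0 A : 0 <= m A.
Proof. by case: mP. Qed.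

Lemma fa_probabilityT : m [set: Y] = 1.
Proof. by case: mP. Qed.

Lemma fa_probabilityU A B : A `&` B = set0 -> m (A `|` B) = m A + m B.
Proof. by case: mP => _ _; exact. Qed.

Lemma fa_probability0 : m set0 = 0.
Proof.
have := fa_probabilityU (setI0 set0).
by rewrite setU0 => /eqP; rewrite -subr_eq0 opprD addNKr oppr_eq0 => /eqP.
Qed.

Lemma le_fa_probability A B : A `<=` B -> m A <= m B.
Proof.
move=> AB; have -> : B = A `|` (B `\` A) by rewrite setDUK.
rewrite fa_probabilityU; first by rewrite lerDl fa_probability_ge0.
by rewrite setDIK.
Qed.

Lemma fa_probabilityU_le A B : m (A `|` B) <= m A + m B.
Proof.
rewrite -(setDUK (@subsetUl _ A B)) fa_probabilityU ?setDIK// lerD2l.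
by apply: le_fa_probability => y [[]].
Qed.

Lemma fa_probability_fibers (T : choiceType) (phi : Y -> T) (A : set Y) :
  finite_set (range phi) ->
  m A = \sum_(t \in range phi) m (A `&` phi @^-1` [set t]).
Proof.
move=> fphi; rewrite fsbig_finite//=.
(* [B u] keeps the points of [A] whose value lies in the list [u]. This generalizes the claim for an
   induction on the list of values; the list has no duplicates, so each new fibre is disjoint from
   the rest. *)
set r := (X in \sum_(t <- X) _); pose B (u : seq T) := A `&` [set y | phi y \in u].
have -> : A = B r.
  rewrite /B; apply/seteqP; split=> y /=; last by case.
  by move=> Ay; split => //; rewrite in_fset_set// inE; exists y.
have -> : \sum_(t <- r) m (B r `&` phi @^-1` [set t]) =
    \sum_(t <- r) m (A `&` phi @^-1` [set t]).
  apply: eq_big_seq => t tr; congr m.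
  apply/seteqP; split=> y /=; first by move=> [[]].
  by move=> [Ay yt]; split=> //; split=> //=; rewrite yt.
have : uniq r by exact: finmap.fset_uniq.
elim: r => [_|t u IH].
  rewrite big_nil -fa_probability0; congr m.
  by apply/seteqP; split=> y // -[].
rewrite cons_uniq big_cons => /andP[tu uu].
rewrite -IH// -fa_probabilityU.
  congr m; apply/seteqP; split=> y.
    by move=> [Ay]; rewrite /= inE => /orP[/eqP->|yu]; [left|right].
  by move=> [[Ay /= <-]|[Ay /= yu]]; split=> //=; rewrite inE ?eqxx// yu orbT.
apply/seteqP; split=> y // -[[_ /= yt] [_ /=]].
by rewrite yt (negbTE tu).
Qed.

(** This computes an integral over any finite partition finer than the level sets. Two simple
    functions can then be compared over a common one, by taking for [phi] the pair of them. *)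
Lemma simple_integral_comp (T : choiceType) (phi : Y -> T) (h : T -> R) :
  finite_set (range phi) ->
  simple_integral m (h \o phi) =
  \sum_(t \in range phi) h t * m (phi @^-1` [set t]).
Proof.
move=> fphi; rewrite /simple_integral.
have fh : finite_set (range (h \o phi)).
  by rewrite -(image_comp phi h); exact: finite_image.
under eq_fsbigr => r _ do
  rewrite (@fa_probability_fibers _ phi ((h \o phi) @^-1` [set r]) fphi).
under eq_fsbigr => r _ do rewrite mulr_fsumr.
rewrite exchange_fsbig//; apply: eq_fsbigr => t; rewrite inE => -[y0 _ y0t].
(* After the exchange of sums, the fibre over [t] meets only the level set of [h t]; all other
   intersections are empty. *)
rewrite (fsbigD1 (h t))//=; last by exists y0 => //=; rewrite y0t.
rewrite fsbig1 ?addr0.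
  congr (_ * m _); apply/seteqP; split=> y /=; first by case.
  by move=> yt; rewrite yt.
move=> r [_ /= rt]; rewrite [X in m X](_ : _ = set0) ?fa_probability0 ?mulr0//.
by apply/seteqP; split=> y //= [+ yt]; rewrite yt => /esym.
Qed.

Lemma simple_integralD s t : finite_set (range s) -> finite_set (range t) ->
  simple_integral m (fun y => s y + t y) =
  simple_integral m s + simple_integral m t.
Proof.
move=> fs ft; pose phi y := (s y, t y).
have fphi : finite_set (range phi) by exact: (finite_image11 (fun a b => (a, b))).
have -> : s = fst \o phi by [].
have -> : t = snd \o phi by [].
rewrite (_ : (fun y => _) = (fun p => p.1 + p.2) \o phi)//.
rewrite !simple_integral_comp// -fsbig_split//.
by apply: eq_fsbigr => p _ /=; rewrite mulrDl.
Qed.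

Lemma le_simple_integral s t : finite_set (range s) -> finite_set (range t) ->
  (forall y, s y <= t y) -> simple_integral m s <= simple_integral m t.
Proof.
move=> fs ft st; pose phi y := (s y, t y).
have fphi : finite_set (range phi) by exact: (finite_image11 (fun a b => (a, b))).
rewrite (_ : s = fst \o phi)// (_ : t = snd \o phi)//.
rewrite !simple_integral_comp// !fsbig_finite//=.
rewrite big_seq [leRHS]big_seq; apply: ler_sum => p.
rewrite in_fset_set// inE => -[y _ <-] /=.
by rewrite ler_wpM2r ?fa_probability_ge0.
Qed.

Lemma finite_range_indic (M : R) (A : set Y) :
  finite_set (range (fun y => M * (y \in A)%:R)).
Proof.
apply: (@sub_finite_set _ _ ([set (fun b : bool => M * b%:R) b | b in setT])).
  by move=> _ [y _ <-]; exists (y \in A).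
exact/finite_image/finite_finset.
Qed.

Lemma simple_integral_indic (M : R) (A : set Y) :
  simple_integral m (fun y => M * (y \in A)%:R) = M * m A.
Proof.
pose phi y := y \in A.
have fphi : finite_set (range phi) by exact: finite_finset.
rewrite (_ : (fun y => _) = (fun b : bool => M * b%:R) \o phi)//.
rewrite simple_integral_comp//.
(* [A] may be empty or everything, so the range may miss a boolean; a missed value has an empty
   fibre, of mass zero. *)
rewrite (fsbig_widen _ [set: bool]) //; last first.
  move=> b [_ /= nb]; rewrite (_ : phi @^-1` _ = set0) ?fa_probability0 ?mulr0//.
  by apply/seteqP; split=> y //= yb; apply: nb; exists y.
rewrite (fsbigD1 true)//; last exact: finite_finset.
rewrite fsbig1; last first.
  by case=> [[_ /= /(_ erefl)]//|_]; rewrite /= mulr0 mul0r.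
rewrite [LHS]addr0 /= mulr1.
congr (_ * m _); apply/seteqP; split=> y /=; first by move/set_mem.
by move/mem_set.
Qed.

Lemma simple_integral_cst (c : R) : simple_integral m (fun=> c) = c.
Proof.
rewrite [X in simple_integral m X](_ : _ = fun y => c * (y \in [set: Y])%:R).
  by rewrite simple_integral_indic fa_probabilityT mulr1.
by apply/funext => y; rewrite in_setT mulr1.
Qed.

End SimpleIntegral.

(** * Monotonicity and uniqueness of the Dunford-Schwartz integral *)

Lemma finite_range_bounded (R : realType) (Y : Type) (s : Y -> R) :
  finite_set (range s) -> exists M, forall y, `|s y| <= M.
Proof.
move=> fs; exists (\sum_(r \in range s) `|r|) => y.
rewrite (fsbigD1 (s y))//=; last by exists y.
by rewrite lerDl; apply: fsumr_ge0 => r _; exact: normr_ge0.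
Qed.

Section DSIntegral.
Variables (R : realType) (Y : Type) (m : set Y -> R).
Hypothesis mP : fa_probability m.
Implicit Types (g : Y -> R) (s : nat -> {fimfun Y >-> R}).

(* With [A] the set where [s n] or [s' n] is [d]-far from its limit,
   [s n <= s' n + |s n - s N| + |s' n - s' N| + 2 d + M 1_A] for any bound
   [M] of [|s N - s' N|]. *)
Lemma le_has_ds_integral g g' v v' :
  has_ds_integral m g v -> has_ds_integral m g' v' ->
  (forall y, g y <= g' y) -> v <= v'.
Proof.
move=> [s [sg sC sv]] [s' [sg' sC' sv']] gg'.
(* The eight errors [d]: one for each limit of integrals, one for each Cauchy distance to index [N],
   two for closeness off [A], and two for [M * m A]. *)
apply/ler_addgt0Pr => e e0; pose d := e / 8.
have d0 : 0 < d by rewrite divr_gt0.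
have [N0 HN0] := sC d d0; have [N1 HN1] := sC' d d0.
pose N := maxn N0 N1.
have [M0 HM0] := @finite_range_bounded R Y (fun y => s N y - s' N y)
  (finite_image11 (fun a b => a - b) (fimfunP (s N)) (fimfunP (s' N))).
(* The added 1 makes [M] positive, so [d / M] is a valid threshold. [M] belongs to the fixed index
   [N], hence [m A] can be made small against it afterwards. *)
pose M := `|M0| + 1; have M_gt0 : 0 < M by rewrite ltr_wpDl.
have HM y : `|s N y - s' N y| <= M.
  by apply: le_trans (HM0 y) _; rewrite (le_trans (ler_norm _))// lerDl.
have dM0 : 0 < d / M by rewrite divr_gt0.
near \oo => n.
pose A := [set y | d < `|s n y - g y|] `|` [set y | d < `|s' n y - g' y|].
have mA : m A <= 2 * (d / M).
  apply: le_trans (fa_probabilityU_le mP _ _) _.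
  rewrite mulr_natl mulr2n; apply: lerD; near: n.
    by apply: cvgr_le (sg d d0) _ _.
  by apply: cvgr_le (sg' d d0) _ _.
have sn : v <= simple_integral m (s n) + d.
  rewrite -lerBlDr; near: n; apply: cvgr_ge sv _ _.
  by rewrite ltrBlDr ltrDl.
have sn' : simple_integral m (s' n) <= v' + d.
  by near: n; apply: cvgr_le sv' _ _; rewrite ltrDl.
have nN : (N <= n)%N by near: n; exact: nbhs_infty_ge.
have Hs : simple_integral m (fun y => `|s n y - s N y|) < d.
  by apply: HN0; [exact: leq_trans (leq_maxl _ _) nN|exact: leq_maxl].
have Hs' : simple_integral m (fun y => `|s' n y - s' N y|) < d.
  by apply: HN1; [exact: leq_trans (leq_maxr _ _) nN|exact: leq_maxr].
have fdist (t u : {fimfun Y >-> R}) : finite_set (range (fun y => `|t y - u y|)).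
  exact: (finite_image11 (fun a b => `|a - b|) (fimfunP t) (fimfunP u)).
have fD (t u : Y -> R) : finite_set (range t) -> finite_set (range u) ->
    finite_set (range (fun y => t y + u y)).
  exact: (finite_image11 (fun a b => a + b)).
have fc (c : R) : finite_set (range (fun _ : Y => c)) by exact: finite_image_cst.
have fi := @finite_range_indic R Y M A.
have : simple_integral m (s n) <= simple_integral m (fun y => s' n y +
    (`|s n y - s N y| + (`|s' n y - s' N y| + (2 * d + M * (y \in A)%:R)))).
  apply: le_simple_integral => // [|y]; first by do 4 (apply: (fD) => //).
  have [yA|yA] := boolP (y \in A).
    rewrite mulr1.
    have := ler_norm (s n y - s N y); have := ler_norm (s N y - s' N y).
    have := HM y; have := ler_norm (- (s' n y - s' N y)); rewrite normrN.
    by lra.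
  rewrite mulr0.
  have [yA1 yA2] : `|s n y - g y| <= d /\ `|s' n y - g' y| <= d.
    by split; rewrite leNgt; apply: contra yA => yA; rewrite inE; [left|right].
  have := ler_norm (s n y - g y); have := ler_norm (- (s' n y - g' y)).
  rewrite normrN; have := gg' y.
  have := normr_ge0 (s n y - s N y); have := normr_ge0 (s' n y - s' N y).
  by lra.
rewrite !simple_integralD//; last 3 first.
- by apply: (fD).
- by apply: (fD) => //; apply: (fD).
- by do 3 (apply: (fD) => //).
rewrite simple_integral_cst// simple_integral_indic//.
have : M * m A <= 2 * d.
  by rewrite mulrC -ler_pdivlMr// -mulrA.
have : e = 8 * d by rewrite /d mulrC divfK.
by lra.
Unshelve. all: by end_near.
Qed.

Lemma ds_integralE g v : has_ds_integral m g v -> ds_integral m g = v.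
Proof.
move=> gv; rewrite /ds_integral; case: xgetP => [w -> gw|/(_ v)//].
by apply/eqP; rewrite eq_le !(le_has_ds_integral (g := g) (g' := g)).
Qed.

Lemma has_ds_integral_cst (c : R) : has_ds_integral m (fun=> c) c.
Proof.
exists (fun=> cst_fimfun c); split.
- move=> e e0; rewrite [X in X @ _](_ : _ = fun=> 0); first exact: cvg_cst.
  apply/funext => n; rewrite -[RHS](fa_probability0 mP); congr m.
  apply/seteqP; split=> y //=.
  by rewrite subrr normr0 ltNge ltW.
- move=> e e0; exists 0%N => j k _ _.
  rewrite [X in simple_integral m X](_ : _ = fun=> 0) ?simple_integral_cst//.
  by apply/funext => y; rewrite /= subrr normr0.
- by rewrite (simple_integral_cst mP); exact: cvg_cst.
Qed.

End DSIntegral.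

(** * Dyadic approximation from below, and integrability of functions bounded below *)

Lemma near_invr_exp2_le (R : realType) (eps : R) : 0 < eps ->
  \forall n \near \oo, 2 ^- n <= eps.
Proof.
move=> eps0; near=> n; rewrite invf_ple ?posrE ?exprn_gt0//.
apply: le_trans (_ : n%:R <= _); last by rewrite -natrX ler_nat ltnW// ltn_expl.
by near: n; apply: filterS (nbhs_infty_gtr (eps^-1)) => n /ltW.
Unshelve. all: by end_near.
Qed.

Section DyadicApproximation.
Variables (R : realType) (Y : Type) (a : R) (g : Y -> R).
Hypothesis ag : forall y, a <= g y.

(** The usual increasing simple approximation: [g - a] is capped at [n] and rounded down to a
    multiple of [2 ^- n]. *)
Definition dyadic (n : nat) (y : Y) : R :=
  a + (Num.trunc (2 ^+ n * Num.min (g y - a) n%:R))%:R / 2 ^+ n.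

Let pow2_gt0 n : 0 < 2 ^+ n :> R.
Proof. by rewrite exprn_gt0. Qed.

Let arg_ge0 n y : 0 <= 2 ^+ n * Num.min (g y - a) n%:R.
Proof. by rewrite mulr_ge0 ?(ltW (pow2_gt0 n))// le_min subr_ge0 ag ler0n. Qed.

Lemma dyadic_ge n y : a <= dyadic n y.
Proof. by rewrite lerDl divr_ge0 ?(ltW (pow2_gt0 n)). Qed.

Lemma dyadic_le n y : dyadic n y <= g y.
Proof.
rewrite /dyadic -lerBrDl ler_pdivrMr//.
apply: le_trans (_ : _ <= 2 ^+ n * Num.min (g y - a) n%:R) _.
  by rewrite truncn_le.
by rewrite mulrC ler_pM2r// ge_min lexx.
Qed.

Lemma dyadicS n y : dyadic n y <= dyadic n.+1 y.
Proof.
(* With denominators cleared, twice the old truncation must be at most the new one; being an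
   integer, it need only lie below the new argument. *)
rewrite lerD2l ler_pdivlMr// exprS mulrCA divfK ?gt_eqF// -natrM ler_nat.
rewrite truncn_ge_nat; last by rewrite -exprS.
rewrite natrM -mulrA ler_pM2l//.
apply: le_trans (_ : 2 ^+ n * Num.min (g y - a) n%:R <= _).
  by rewrite truncn_le.
by rewrite ler_pM2l// le_min !ge_min lexx /= ler_nat leqnSn orbT.
Qed.

Lemma finite_range_dyadic n : finite_set (range (dyadic n)).
Proof.
apply: (@sub_finite_set _ _
  [set a + k%:R / 2 ^+ n | k in `I_(2 ^ n * n).+1]); last first.
  exact/finite_image/finite_II.
move=> _ [y _ <-]; exists (Num.trunc (2 ^+ n * Num.min (g y - a) n%:R)) => //=.
rewrite ltnS -(ler_nat R) (le_trans (_ : _ <= 2 ^+ n * Num.min (g y - a) n%:R))//.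
  by rewrite truncn_le.
by rewrite natrM natrX ler_pM2l// ge_min lexx orbT.
Qed.

Lemma dyadic_large n y : n%:R <= g y - a -> dyadic n y = a + n%:R.
Proof.
move=> ng; rewrite /dyadic min_r// -natrX -natrM natrK natrM natrX.
by rewrite mulrAC mulfV ?mul1r// gt_eqF.
Qed.

Lemma dyadic_near n y : g y - a < n%:R -> g y - dyadic n y <= (2 ^+ n)^-1.
Proof.
move=> gn; rewrite /dyadic min_l ?(ltW gn)//.
have := truncnS_gt (2 ^+ n * (g y - a)); set k := Num.trunc _ => H.
rewrite opprD addrA lerBlDr (_ : _ + _ / _ = (1 + k%:R) / 2 ^+ n);
  last by rewrite mulrDl mul1r.
rewrite ler_pdivlMr// mulrC.
by rewrite [1 + _]addrC natr1 ltW.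
Qed.

End DyadicApproximation.

(** The dyadic approximations increase and their integrals are bounded by [C], so these converge.
    Convergence in measure needs a separate argument, as [g] may be unbounded above: a Chebyshev
    bound controls the set where the cap is active. *)
Lemma has_ds_integral_sup (R : realType) (Y : Type) (m : set Y -> R)
    (g : Y -> R) (a C : R) :
  fa_probability m -> (forall y, a <= g y) ->
  (forall t : Y -> R, finite_set (range t) -> (forall y, t y <= g y) ->
    simple_integral m t <= C) ->
  exists2 v, has_ds_integral m g v & v <= C.
Proof.
move=> mP ag gC.
pose s n : {fimfun Y >-> R} := 
  fimfun_Sub (mem_set (finite_range_dyadic ag n) : dyadic a g n \in fimfun).
pose I n := simple_integral m (s n).
have IC n : I n <= C by apply: gC => // y; exact: dyadic_le.
have s_mono n k : (n <= k)%N -> forall y, s n y <= s k y.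
  move=> /subnK <- y; elim: (k - n)%N => // i IH.
  by apply: le_trans IH _; exact: dyadicS.
have I_mono : {homo I : n k / (n <= k)%N >-> n <= k}.
  by move=> n k nk; apply: le_simple_integral => // y; exact: s_mono.
have Icvg : cvgn I.
  by apply: nondecreasing_is_cvgn => //; exists C => _ [n _ <-].
exists (limn I); last by apply: limr_le => //; exact: nearW.
exists s; split => //.
- move=> e e0; apply/cvgrPdist_lt => eps eps0; near=> n.
  rewrite sub0r normrN ger0_norm ?fa_probability_ge0//.
  have n0 : 0 < n%:R :> R by near: n; exact: nbhs_infty_gtr.
  have ne : 2 ^- n <= e by near: n; exact: near_invr_exp2_le.
  have neps : (C - a) / eps < n%:R by near: n; exact: nbhs_infty_gtr.
  apply: le_lt_trans (_ : m [set y | n%:R <= g y - a] < _).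
    (* Where the cap is inactive the error is at most [2 ^- n <= e]. *)
    apply: le_fa_probability => // y /=; rewrite leNgt => ey.
    apply/negP => yn; have gn := dyadic_near yn.
    move: ey; apply/negP; rewrite -leNgt.
    by rewrite distrC ger0_norm ?subr_ge0 ?dyadic_le// (le_trans gn).
  rewrite ltr_pdivrMr// in neps.
  rewrite -(ltr_pM2l n0); apply: le_lt_trans neps.
  (* Chebyshev: [n] times the indicator of the capped set, plus [a], lies below [s n], whose
     integral is at most [C]. *)
  rewrite lerBrDr -(simple_integral_indic mP) -[X in _ + X](simple_integral_cst mP).
  rewrite -simple_integralD//; [|exact: finite_range_indic|exact: finite_image_cst].
  apply: le_trans (IC n); apply: le_simple_integral => // [|y].
    by apply: (finite_image11 (fun a b => a + b));
      [exact: finite_range_indic|exact: finite_image_cst].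
  have [|yn] := boolP (y \in _).
    by rewrite inE /= => yn; rewrite /= (dyadic_large yn) mulr1 addrC.
  by rewrite mulr0 add0r; exact: dyadic_ge.
- move=> e e0.
  have e20 : 0 < e / 2 by rewrite divr_gt0.
  have /cvgrPdist_lt/(_ _ e20)[N _ HN] := Icvg.
  exists N => j k Nj Nk.
  have {HN} HI i : (N <= i)%N -> `|limn I - I i| < e / 2 by move=> /HN.
  (* By monotonicity in the index, the mean distance is a difference of integrals, so the Cauchy
     property follows from convergence of [I]. *)
  suff dist i l : (i <= l)%N ->
      simple_integral m (fun y => `|s l y - s i y|) = I l - I i.
    have := HI _ Nj; have := HI _ Nk; rewrite !ltr_norml => /andP[? ?] /andP[? ?].
    have [jk|/ltnW kj] := leqP j k; last by rewrite dist//; lra.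
    rewrite [X in simple_integral m X](_ : _ = fun y => `|s k y - s j y|).
      by rewrite dist//; lra.
    by apply/funext => y; rewrite distrC.
  move=> il; rewrite -[X in X - _](_ :
      simple_integral m (fun y => `|s l y - s i y| + s i y) = I l).
    by rewrite simple_integralD ?addrK//;
      exact: (finite_image11 (fun a b => `|a - b|) (fimfunP (s l))
        (fimfunP (s i))).
  congr simple_integral; apply/funext => y.
  by rewrite ger0_norm ?subrK// subr_ge0 s_mono.
Unshelve. all: by end_near.
Qed.

(** * The vector space of simple functions and its positive functionals *)

Section FimfunLmodule.
Variables (Y : Type) (R : realType).
Implicit Types (f : {fimfun Y >-> R}) (a b : R).

Definition fimfun_scale a f : {fimfun Y >-> R} := *%R a \o f.

Fact fimfun_scaleA a b f :
  fimfun_scale a (fimfun_scale b f) = fimfun_scale (a * b) f.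
Proof. by apply/fimfuneqP => y /=; rewrite mulrA. Qed.

Fact fimfun_scale1 : left_id 1 fimfun_scale.
Proof. by move=> f; apply/fimfuneqP => y /=; rewrite mul1r. Qed.

Fact fimfun_scaleDr : right_distributive fimfun_scale +%R.
Proof. by move=> a f g; apply/fimfuneqP => y /=; rewrite mulrDr. Qed.

Fact fimfun_scaleDl f : {morph fimfun_scale^~ f : a b / a + b}.
Proof. by move=> a b; apply/fimfuneqP => y /=; rewrite mulrDl. Qed.

HB.instance Definition _ := GRing.Zmodule_isLmodule.Build R {fimfun Y >-> R}
  fimfun_scaleA fimfun_scale1 fimfun_scaleDr fimfun_scaleDl.

Lemma fimfunZ a f y : (a *: f) y = a * f y.
Proof. by []. Qed.

Definition fimfun_indic (A : set Y) : {fimfun Y >-> R} :=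
  fimfun_Sub (mem_set (finite_range_indic 1 A) :
    (fun y => 1 * (y \in A)%:R) \in fimfun).

Lemma fimfun_indicE A y : fimfun_indic A y = (y \in A)%:R.
Proof. exact: mul1r. Qed.

End FimfunLmodule.

(** The probability is [l] on indicators; a simple function is the finite sum of its values times
    the indicators of its level sets, so linearity recovers [l]. *)
Lemma positive_functional_integral (R : realType) (Y : Type)
    (l : {fimfun Y >-> R} -> R) :
  (forall u v, l (u + v) = l u + l v) -> (forall a u, l (a *: u) = a * l u) ->
  (forall u : {fimfun Y >-> R}, (forall y, 0 <= u y) -> 0 <= l u) ->
  l (cst_fimfun 1) = 1 ->
  exists m, fa_probability m /\
    forall s : {fimfun Y >-> R}, simple_integral m s = l s.
Proof.
move=> lD lZ l_ge0 l1.
have l0 : l 0 = 0 by rewrite -(scale0r 0) lZ mul0r.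
exists (fun A => l (fimfun_indic R A)); split.
  split=> [A||A B AB].
  - by apply: l_ge0 => y; rewrite fimfun_indicE.
  - rewrite -[RHS]l1; congr l; apply/fimfuneqP => y.
    by rewrite fimfun_indicE in_setT.
  - rewrite -lD; congr l; apply/fimfuneqP => y.
    rewrite fimfunD /= !mul1r in_setU.
    have [yA|yA] := boolP (y \in A); have [yB|yB] := boolP (y \in B);
      rewrite ?addr0 ?add0r//.
    have : (A `&` B) y by split; exact: set_mem.
    by rewrite AB.
move=> s; rewrite /simple_integral fsbig_finite//=.
under eq_bigr do rewrite -lZ.
rewrite -(big_morph l lD l0); congr l; apply/fimfuneqP => y.
rewrite fimfun_sum fimfunE fsbig_finite//=; apply: eq_bigr => r _.
by rewrite mul1r indicE.
Qed.

(** * The sublinear functional of the minimax problem and the probability it yields *)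

Section MinimaxFunctional.
Variables (R : realType) (X Y : Type) (e : X -> Y -> R) (c : R) (x0 : X).
Hypothesis e_concave : forall x x' t eps, 0 <= t <= 1 -> 0 < eps ->
  exists x'', forall y, t * e x y + (1 - t) * e x' y <= e x'' y + eps.
Hypothesis e_inf : forall x eps, 0 < eps -> exists y, e x y <= c + eps.

(* The values [t] forced to be upper bounds of [l u] by [l (e x - c) <= 0]. *)
Definition upper_values (u : {fimfun Y >-> R}) : set R :=
  [set t | exists k x, 0 <= k /\ forall y, u y <= t + k * (e x y - c)].

(** At a point where [e x] nearly drops to [c], the penalty [k * (e x y - c)] is at most [eps]. The
    lemma keeps the infimum finite and gives its value at zero. *)
Lemma upper_values_ge (u : {fimfun Y >-> R}) t b :
  upper_values u t -> (forall y, b <= u y) -> b <= t.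
Proof.
move=> [k [x [k0 ut]]] bu; apply/ler_addgt0Pr => eps eps0.
(* Dividing by [k + 1] instead of [k] covers [k = 0]. *)
have k1 : 0 < k + 1 by rewrite ltr_wpDl.
have [y ey] := e_inf x (divr_gt0 eps0 k1).
have := le_trans (bu y) (ut y); move=> /le_trans; apply; rewrite lerD2l.
apply: le_trans (_ : k * (eps / (k + 1)) <= _).
  by rewrite ler_wpM2l// lerBlDl.
by rewrite mulrCA -[leRHS]mulr1 ler_pM2l// ler_pdivrMr// mul1r lerDl.
Qed.

Lemma has_inf_upper_values u : has_inf (upper_values u).
Proof.
have [M HM] := finite_range_bounded (fimfunP u).
split.
  exists M, 0, x0; split=> // y.
  by rewrite mul0r addr0 (le_trans _ (HM y))// ler_norm.
exists (- M) => t /upper_values_ge; apply => y.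
by rewrite lerNl (le_trans _ (HM y))// -normrN ler_norm.
Qed.

Definition upper_functional u := inf (upper_values u).

Lemma upper_functional_le u t : upper_values u t -> upper_functional u <= t.
Proof. by move=> ut; apply: ge_inf => //; case: (has_inf_upper_values u). Qed.

Lemma upper_functional_ge u b :
  (forall t, upper_values u t -> b <= t) -> b <= upper_functional u.
Proof. by move=> ub; apply: lb_le_inf => //; case: (has_inf_upper_values u). Qed.

(** The two penalties add up to [k + k'] times a convex combination of [e x] and [e x'], which
    concavity replaces by a single [e x''] at the cost of [eps]. *)
Lemma upper_valuesD u v s t eps : 0 < eps ->
  upper_values u s -> upper_values v t -> upper_values (u + v) (s + t + eps).
Proof.
move=> eps0 [k [x [k0 us]]] [k' [x' [k'0 vt]]].
(* If both weights vanish there is no combination to form, and any point serves as witness. *)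
have [K0|K0] := eqVneq (k + k') 0.
  exists 0, x0; split => // y.
  have k00 : k = 0 by apply/eqP; rewrite eq_le k0 andbT -K0 lerDl.
  have k'00 : k' = 0 by apply/eqP; rewrite eq_le k'0 andbT -K0 lerDr.
  have := us y; have := vt y; rewrite fimfunD /= k00 k'00 !mul0r.
  by lra.
have Kgt0 : 0 < k + k' by rewrite lt0r K0 addr_ge0.
have t01 : 0 <= k / (k + k') <= 1.
  by rewrite divr_ge0 ?addr_ge0// ler_pdivrMr// mul1r lerDl.
have [x'' Hx] := e_concave x x' t01 (divr_gt0 eps0 Kgt0).
exists (k + k'), x''; split => [|y]; first exact: ltW.
have := Hx y; rewrite -(ler_pM2l Kgt0).
have -> : (k + k') * (k / (k + k') * e x y + (1 - k / (k + k')) * e x' y) =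
    k * e x y + k' * e x' y by field.
have -> : (k + k') * (e x'' y + eps / (k + k')) = (k + k') * e x'' y + eps.
  by field.
have := us y; have := vt y; rewrite fimfunD /=.
by lra.
Qed.

Lemma upper_valuesZ a u t : 0 <= a ->
  upper_values u t -> upper_values (a *: u) (a * t).
Proof.
move=> a0 [k [x [k0 ut]]]; exists (a * k), x; split; first exact: mulr_ge0.
by move=> y; rewrite fimfunZ -mulrA -mulrDr ler_wpM2l.
Qed.

Lemma upper_functional_sublinear : sublinear upper_functional.
Proof.
split=> [u v|a u].
  rewrite -lerBlDr; apply: upper_functional_ge => s us.
  rewrite lerBlDl -lerBlDr; apply: upper_functional_ge => t vt.
  rewrite lerBlDr; apply/ler_addgt0Pr => eps eps0.
  by rewrite [t + s]addrC; apply: upper_functional_le; exact: upper_valuesD.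
have leZ b w : 0 < b -> upper_functional (b *: w) <= b * upper_functional w.
  move=> b0; rewrite -ler_pdivrMl//; apply: upper_functional_ge => t wt.
  by rewrite ler_pdivrMl//; apply: upper_functional_le; exact/upper_valuesZ/wt/ltW.
rewrite le_eqVlt => /predU1P[<-|a0].
  rewrite scale0r mul0r; apply/eqP; rewrite eq_le; apply/andP; split.
    by apply: upper_functional_le; exists 0, x0; split => // y; rewrite mul0r addr0.
  by apply: upper_functional_ge => t /upper_values_ge; apply.
(* The reverse inequality is [leZ] for the scalar [a^-1] applied to [a *: u]. *)
apply/eqP; rewrite eq_le leZ//= -ler_pdivlMl//.
by rewrite -[u in leLHS](scalerK (a := a)) ?gt_eqF// leZ// invr_gt0.
Qed.

(** Upper values with weight [k = 0] make the Hahn-Banach functional positive and normalized; weight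
    [k = 1] gives the bound [c] below [e x]. *)
Lemma exists_minimax_functional : exists m : set Y -> R, fa_probability m /\
  forall x s, finite_set (range s) -> (forall y, s y <= e x y) ->
    simple_integral m s <= c.
Proof.
have [l [lD lZ lp]] := hahn_banach upper_functional_sublinear.
have l_le u t : upper_values u t -> l u <= t.
  by move=> ut; apply: le_trans (lp u) _; exact: upper_functional_le.
have lN u : l (- u) = - l u by rewrite -scaleN1r lZ mulN1r.
have [| |m [mP ml]] := positive_functional_integral lD lZ.
- move=> u u0; rewrite -lerN2 oppr0 -lN; apply: l_le.
  by exists 0, x0; split=> // y; rewrite mul0r addr0 /= oppr_le0.
- apply/eqP; rewrite eq_le; apply/andP; split.
    by apply: l_le; exists 0, x0; split=> // y; rewrite mul0r addr0.
  rewrite -lerN2 -lN; apply: l_le.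
  by exists 0, x0; split=> // y; rewrite mul0r addr0.
exists m; split => // x s fs sx.
rewrite (ml (fimfun_Sub (mem_set fs : s \in fimfun))); apply: l_le.
by exists 1, x; split => // y; rewrite mul1r addrC subrK; exact: sx.
Qed.

End MinimaxFunctional.

(** * Dirac masses *)

Lemma fa_probability_dirac (R : realType) (Y : Type) (y0 : Y) :
  fa_probability (fun A : set Y => (y0 \in A)%:R : R).
Proof.
split=> [A||A B AB]; rewrite ?in_setT ?in_setU//.
have [yA|yA] := boolP (y0 \in A); have [yB|yB] := boolP (y0 \in B);
  rewrite ?addr0 ?add0r//.
have : (A `&` B) y0 by split; exact: set_mem.
by rewrite AB.
Qed.

(** The constant sequence [g y0] converges to [g] in measure, since the set where they differ misses
    [y0] and so is null. *)
Lemma has_ds_integral_dirac (R : realType) (Y : Type) (y0 : Y) (g : Y -> R) :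
  has_ds_integral (fun A : set Y => (y0 \in A)%:R : R) g (g y0).
Proof.
have dP := fa_probability_dirac R y0.
exists (fun=> cst_fimfun (g y0)); split.
- move=> e e0; rewrite [X in X @ _](_ : _ = fun=> 0); first exact: cvg_cst.
  apply/funext => n; rewrite memNset//= subrr normr0 => /lt_trans/(_ e0).
  by rewrite ltxx.
- move=> e e0; exists 0%N => j k _ _.
  rewrite [X in simple_integral _ X](_ : _ = fun=> 0) ?simple_integral_cst//.
  by apply/funext => y; rewrite /= subrr normr0.
- by rewrite (simple_integral_cst dP); exact: cvg_cst.
Qed.

(** * The minimax equalities for a pseudo concave family *)

Section Minimax.
Variables (R : realType) (X : Type) (F : set (X -> R)).
Hypotheses (X_nonempty : [set: X] !=set0) (F_nonempty : F !=set0).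
Hypothesis F_lower_bounded : pointwise_lower_bounded F.
Hypothesis F_concave : pseudo_concave F.

Let inf_at (x : X) : \bar R := ereal_inf [set (f x)%:E | f in F].

Lemma inf_at_le f x : F f -> (inf_at x <= (f x)%:E)%E.
Proof. by move=> Ff; apply: ereal_inf_lbound; exists f. Qed.

Lemma inf_at_fin_num x : inf_at x \is a fin_num.
Proof.
have [f0 Ff0] := F_nonempty.
by rewrite fin_real// F_lower_bounded (le_lt_trans (inf_at_le _ Ff0))// ltry.
Qed.

Lemma evaluation_ge x (f : F) : fine (inf_at x) <= evaluation F x f.
Proof.
rewrite -lee_fin fineK ?inf_at_fin_num//; apply: inf_at_le.
exact: set_mem (valP f).
Qed.

Lemma inf_at_le_integral m x : fa_probabilities (evaluations F) m ->
  (inf_at x <= (ds_integral m (evaluation F x))%:E)%E.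
Proof.
move=> [mP mL]; have [|v xv] := mL (evaluation F x); first by exists x.
rewrite -(fineK (inf_at_fin_num x)) lee_fin (ds_integralE mP xv).
exact: (le_has_ds_integral mP (has_ds_integral_cst mP _) xv (evaluation_ge x)).
Qed.

Lemma exists_minimax_probability :
  exists2 m, fa_probabilities (evaluations F) m &
    forall x, ((ds_integral m (evaluation F x))%:E <=
      ereal_sup [set inf_at x | x in [set: X]])%E.
Proof.
have [f0 Ff0] := F_nonempty; have [x0 _] := X_nonempty.
pose y0 : F := SigSub (mem_set Ff0).
have inf_le x : (inf_at x <= ereal_sup [set inf_at x | x in [set: X]])%E.
  by apply: ereal_sup_ubound; exists x.
(* The value [-oo] contradicts the lower bound at [x0]; for [+oo] the inequality is void and only
   some probability integrating all evaluations is needed. *)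
move: inf_le; case: (ereal_sup _) => [c| |] inf_le; last first.
- have := inf_le x0; rewrite leeNy_eq => /eqP Ix0.
  by have := F_lower_bounded x0; rewrite /inf_at in Ix0; rewrite Ix0 ltxx.
- exists (fun A : set F => (y0 \in A)%:R); last by move=> x; rewrite leey.
  split; first exact: fa_probability_dirac.
  by move=> _ [x _ <-]; exists (evaluation F x y0); exact: has_ds_integral_dirac.
have concave x x' t eps : 0 <= t <= 1 -> 0 < eps -> exists x'', forall y,
    t * evaluation F x y + (1 - t) * evaluation F x' y <=
    evaluation F x'' y + eps.
  move=> t01 eps0; have [xs Hxs] := F_concave x x' t01.
  near \oo => n; exists (xs n) => y.
  apply: le_trans (Hxs _ n (set_mem (valP y))) _; rewrite lerD2l.
  by near: n; exact: near_invr_exp2_le.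
have infc x eps : 0 < eps -> exists y, evaluation F x y <= c + eps.
  move=> eps0; have : (inf_at x < (c + eps)%:E)%E.
    by rewrite (le_lt_trans (inf_le x))// lte_fin ltrDl.
  move=> /ereal_inf_lt[_ [f Ff <-]]; rewrite lte_fin => /ltW fx.
  by exists (SigSub (mem_set Ff)).
have [m [mP mc]] := exists_minimax_functional x0 concave infc.
(* Each evaluation is bounded below by its own infimum over [F], so the bound on simple minorants
   passes to its integral. *)
have mE x := has_ds_integral_sup mP (evaluation_ge x) (mc x).
exists m; last first.
  by move=> x; have [v xv vc] := mE x; rewrite (ds_integralE mP xv) lee_fin.
by split => // _ [x _ <-]; have [v xv _] := mE x; exists v.
Unshelve. all: by end_near.
Qed.

End Minimax.

Theorem theorem1 (R : realType) (X : Type) (F : set (X -> R))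
    (X_nonempty : [set: X] !=set0) (F_nonempty : F !=set0)
    (F_lower_bounded : pointwise_lower_bounded F)
    (F_concave : pseudo_concave F) :
  let sup_integral (m : set F -> R) : \bar R :=
    ereal_sup [set (ds_integral m (evaluation F x))%:E | x in [set: X]] in
  let sup_inf : \bar R :=
    ereal_sup [set ereal_inf [set (f x)%:E | f in F] | x in [set: X]] in
  [/\ ereal_inf [set sup_integral m | m in fa_probabilities (evaluations F)]
        = sup_inf,
      exists m : set F -> R, fa_probabilities (evaluations F) m /\
        sup_integral m =
          ereal_inf [set sup_integral m' | m' in fa_probabilities (evaluations F)]
    & pseudo_B_convex (evaluations F) ->
      ereal_inf [set ereal_sup [set (f x)%:E | x in [set: X]] | f in F]
        = sup_inf].
Proof.
move=> sup_integral sup_inf.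
have [m mP m_le] := exists_minimax_probability X_nonempty F_nonempty
  F_lower_bounded F_concave.
have mle : (sup_integral m <= sup_inf)%E.
  by apply: ge_ereal_sup => _ [x _ <-]; exact: m_le.
have ge_m m' : fa_probabilities (evaluations F) m' ->
    (sup_inf <= sup_integral m')%E.
  move=> m'P; apply: ge_ereal_sup => _ [x _ <-].
  apply: le_trans (inf_at_le_integral F_nonempty F_lower_bounded x m'P) _.
  by apply: ereal_sup_ubound; exists x.
have infE : ereal_inf [set sup_integral m | m in fa_probabilities (evaluations F)]
    = sup_inf.
  apply/eqP; rewrite eq_le; apply/andP; split.
    by apply: le_trans mle; apply: ereal_inf_lbound; exists m.
  by apply: le_ereal_inf_tmp => _ [m' m'P <-]; exact: ge_m.
split => //.
  by exists m; split=> //; rewrite infE; apply/eqP; rewrite eq_le mle ge_m.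
(* Pseudo convexity is applied to the minimizing [m]: the function [ys n] exceeds the integrals,
   hence [sup_inf], by at most [2 ^- n], uniformly in [x]. *)
move=> /(_ _ mP)[ys Hys]; apply/eqP; rewrite eq_le; apply/andP; split; last first.
  apply: ge_ereal_sup => _ [x _ <-]; apply: le_ereal_inf_tmp => _ [f Ff <-].
  by apply: le_trans (inf_at_le x Ff) _; apply: ereal_sup_ubound; exists x.
apply/lee_addgt0Pr => eps eps0; near \oo => n.
apply: le_trans (_ : (ereal_sup [set (val (ys n) x)%:E | x in [set: X]] <= _)%E).
  by apply: ereal_inf_lbound; exists (val (ys n)) => //; exact: set_mem (valP (ys n)).
apply: ge_ereal_sup => _ [x _ <-].
have /Hys : evaluations F (evaluation F x) by exists x.
move=> /(_ n) H.
apply: le_trans (_ : (_ <= (ds_integral m (evaluation F x))%:E + eps%:E)%E) _.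
  rewrite -EFinD lee_fin; apply: le_trans H _; rewrite lerD2l.
  by near: n; exact: near_invr_exp2_le.
by rewrite leeD2r// m_le.
Unshelve. all: by end_near.
Qed.
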